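(* Let $k$ be a prime power, and let $m=4k$, $W$, $K\subset\mathbb{R}^W$ be as defined in the context. Put $d=\binom{m}{2}-1$ and $$q=\frac{\frac12\binom{m}{2k}}{\binom{m-1}{k-1}}=\frac{\binom{m}{2k}}{2\binom{m-1}{k-1}}.$$ Then the point set $K$ lies in a Euclidean space of dimension $d$ (i.e. in a $d$-dimensional affine subspace of $\mathbb{R}^W$), and $K$ cannot be covered by fewer than $q$ subsets of smaller diameter: if $P$ is a family of subsets $T\subseteq K$, each with $\mathrm{diam}(T)<\mathrm{diam}(K)$, and $\bigcup_{T\in P}T=K$, then $|P|\ge q$. Consequently, if $q>d+1$, then $K$ is a counterexample to Borsuk's conjecture in dimension $d$ and in all higher dimensions below $q-1$.
   Context: A prime power is $p^a$ with $p$ prime and $a\ge 1$ an integer. Construction of $K$: let $m=4k$, $V=\{1,2,\dots,m\}$, and let $W=\{\{a,b\}: a,b\in V,\ a\ne b\}$ be the set of 2-element subsets of $V$. Let $H=\{A\subset V: |A|=2k\}$. For $A\in H$ let $N(A)=V\setminus A$ and $S(A)=\{\{a,b\}: a\in A,\ b\in N(A)\}\subseteq W$. Let $K=\{S(A):A\in H\}$ (a set of subsets of $W$, without repetition; $S(A)=S(N(A))$). Each subset $X\subseteq W$ is identified with its $\{0,1\}$-indicator vector in $\mathbb{R}^W$, so $K$ is a finite point set in $\mathbb{R}^W$, and the Euclidean distance is $\mathrm{dist}(X,Y)=\sqrt{|X\triangle Y|}$, where $\triangle$ is symmetric difference. For $T\subseteq K$, $\mathrm{diam}(T)=\max(\{\mathrm{dist}(X,Y):X,Y\in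 T\}\cup\{0\})$. Borsuk's conjecture in dimension $n$: every bounded subset of $n$-dimensional Euclidean space containing at least two points can be divided into $n+1$ parts of smaller diameter than the whole set. A set is a counterexample in dimension $n$ if it is (isometric to) a bounded subset of $n$-dimensional Euclidean space with at least two points that cannot be divided into $n+1$ parts of smaller diameter. *)

(* Defs.v *)
From HB Require Import structures.
From mathcomp Require Import all_boot all_order all_algebra.
From mathcomp Require Import boolp classical_sets reals.

Set Implicit Arguments.
Unset Strict Implicit.
Unset Printing Implicit Defensive.

Import Order.TTheory GRing.Theory Num.Theory.

Local Open Scope classical_set_scope.
Local Open Scope ring_scope.

Definition prime_power (n : nat) : Prop :=
  exists p a : nat, [/\ prime p, (0 < a)%N & n = (p ^ a)%N].

(* [R^o] rather than [R] makes the function space a [vectType R]. *)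
Notation euclidean R I := {ffun I -> R^o}.

Section Euclidean.
Variables (R : realType) (I : finType).
Implicit Types (x y p : euclidean R I) (S : set (euclidean R I)).

Definition edist x y : R := Num.sqrt (\sum_(i : I) (x i - y i) ^+ 2).

(* Adding 0 gives the empty set diameter 0; on a finite set the supremum is a
   maximum (see [diam_ub] and [diam_attained]).  Meaningful only for bounded
   sets: [sup] is 0 on sets without an upper bound. *)
Definition diam S : R :=
  sup [set r : R | r = 0 \/ exists x y, [/\ S x, S y & r = edist x y]].

Definition ebounded S : Prop := exists M : R, forall x, S x -> edist x 0 <= M.

(* Parts are allowed to be empty: division into N parts means into at most N
   nonempty ones. *)
Definition divisible_into_smaller (N : nat) S : Prop :=
  exists F : 'I_N -> set (euclidean R I),
    [/\ \bigcup_i F i = S, trivIset [set: 'I_N] F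
      & forall i, diam (F i) < diam S].

Definition in_affine_subspace_of_dim (d : nat) S : Prop :=
  exists (p : euclidean R I) (U : {vspace euclidean R I}),
    (\dim U)%VS = d /\ forall x, S x -> x - p \in U.

End Euclidean.

Definition isometric_sets (R : realType) (I J : finType)
    (S : set (euclidean R I)) (T : set (euclidean R J)) : Prop :=
  exists f : euclidean R I -> euclidean R J,
    f @` S = T /\ forall x y, S x -> S y -> edist (f x) (f y) = edist x y.

Definition borsuk_counterexample (R : realType) (I : finType) (n : nat)
    (S : set (euclidean R I)) : Prop :=
  exists T : set (euclidean R 'I_n),
    [/\ isometric_sets S T, ebounded T,
        exists x y, [/\ T x, T y & x <> y]
      & ~ divisible_into_smaller n.+1 T].

Section Construction.
Variable k : nat.

(* The ground set {1, ..., 4k} is represented by {0, ..., 4k - 1}. *)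
Definition ptV : finType := 'I_(4 * k).

Definition pairW : finType := {e : {set ptV} | #|e| == 2}.

Definition halfH : {set {set ptV}} :=
  [set A : {set ptV} | #|A| == (2 * k)%N]%SET.

Definition complN (A : {set ptV}) : {set ptV} := (~: A)%SET.

Definition cutS (A : {set ptV}) : {set pairW} :=
  [set w : pairW |
    [exists a in A, exists b in complN A, val w == [set a; b]%SET]]%SET.

Definition setK : {set {set pairW}} := [set cutS A | A in halfH]%SET.

End Construction.

Section Points.
Variables (R : realType) (I : finType).

Definition indicator (X : {set I}) : euclidean R I := [ffun i => (i \in X)%:R].

Definition points (T : {set {set I}}) : set (euclidean R I) :=
  indicator @` [set X | X \in T].

(* The set under the cardinal is the symmetric difference of X and Y. *)
Lemma edist_indicator (X Y : {set I}) :
  edist (indicator X) (indicator Y)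
  = Num.sqrt (#|((X :\: Y) :|: (Y :\: X))%SET|%:R).
Proof.
rewrite /edist -sum1_card natr_sum [in RHS]big_mkcond /=; congr Num.sqrt.
apply: eq_bigr => i _; rewrite !ffunE !inE.
by case: (i \in X); case: (i \in Y);
  rewrite /= ?subrr ?subr0 ?sub0r ?expr0n ?sqrrN ?expr1n.
Qed.

Let dists (T : {set {set I}}) : set R :=
  [set r : R | r = 0 \/
     exists x y, [/\ points T x, points T y & r = edist x y]].

Let diam_max (T : {set {set I}}) : R :=
  \big[Num.max/0]_(u : {set I} * {set I} | (u.1 \in T) && (u.2 \in T))
    edist (indicator u.1) (indicator u.2).

Let diam_max_ub T : ubound (dists T) (diam_max T).
Proof.
move=> r [->|[_ [_ [[X XT <-] [Y YT <-] ->]]]].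
  by rewrite /diam_max; elim/big_rec: _ => // u s _ s0; rewrite le_max s0 orbT.
by rewrite /diam_max (bigD1 (X, Y)) ?XT //= le_max lexx.
Qed.

Let diam_max_in T : dists T (diam_max T).
Proof.
rewrite /diam_max; elim/big_ind: _ => [|r s Dr Ds|[X Y] /= /andP[XT YT]].
- by left.
- by rewrite maxEle; case: ifP.
- by right; exists (indicator X), (indicator Y); split=> //;
    [exists X | exists Y].
Qed.

Let diamE T : diam (points T) = diam_max T.
Proof.
apply/eqP; rewrite eq_le; apply/andP; split.
  by apply: ge_sup; [exists 0; left | exact: diam_max_ub].
by apply: ub_le_sup; [exists (diam_max T); exact: diam_max_ub
                     | exact: diam_max_in].
Qed.

Lemma diam_ub (T : {set {set I}}) x y :
  points T x -> points T y -> edist x y <= diam (points T).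
Proof.
by move=> Tx Ty; rewrite diamE; apply: diam_max_ub; right; exists x, y.
Qed.

Lemma diam_attained (T : {set {set I}}) :
  diam (points T) = 0 \/
  exists x y, [/\ points T x, points T y & diam (points T) = edist x y].
Proof. by rewrite diamE; exact: diam_max_in. Qed.

End Points.

Arguments points R {I} T.

(* Main.v *)
Require Import Defs.
From HB Require Import structures.
From mathcomp Require Import all_boot all_order all_algebra.
From mathcomp Require Import boolp classical_sets reals.
From mathcomp Require Import zify ring.

Set Implicit Arguments.
Unset Strict Implicit.
Unset Printing Implicit Defensive.

Import Order.TTheory GRing.Theory Num.Theory.

Local Open Scope ring_scope.

(** The symmetric difference of two cuts is a cut: [S(A) + S(B) = S(A + B)],
    with [+] for the symmetric difference.
    A set of size [c] has a cut of size [c (4k - c)], so for [A], [B] of size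
    [2k] with [t] common points the squared distance between [S(A)] and [S(B)]
    is [4 t (2k - t)], which is largest exactly when [t = k].  Hence a part of
    smaller diameter contains no [S(A)], [S(B)] with [A] and [B] meeting in
    exactly [k] points ([diam_setK_le]).

    How many sets can such a part contain?  Since [S(A)] is also the cut of the
    complement of [A], it suffices to count the [A] through a fixed point [o],
    of which there are [C(4k, 2k) / 2].  Two different ones meet in [t] points
    with [0 < t < 2k], and [t = k] is excluded, so [k] does not divide [t].
    This is where [k = p ^ a] enters: [C(t - 1, k - 1)] is then divisible by
    [p], while it is 1 modulo [p] for [t = 2k].  As [C(t - 1, k - 1)] counts
    the [(k - 1)]-subsets of [A :&: B] that avoid [o], these numbers form the
    Gram matrix of the inclusion vectors of the [A] in a space of dimension
    [C(4k - 1, k - 1)].  Modulo [p] the Gram matrix is the identity, so there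
    are at most [C(4k - 1, k - 1)] sets ([card_family_avoiding]), and the bound [q]
    on the number of parts follows by division ([cover_bound]).

    All cuts in [K] have [4 k ^ 2] elements, so [K] lies in a hyperplane of
    constant coordinate sum, of dimension [d].  An explicit linear map takes
    this hyperplane isometrically into [R ^ n] for every [n >= d]
    ([hyperplane_isometry]), and any division of the image into [n + 1] parts of
    smaller diameter would contradict the bound when [n + 1 < q]. *)

(** * Binomial coefficients modulo the prime *)

Lemma prime_power_gt0 n : prime_power n -> (0 < n)%N.
Proof. by case=> p [a [pr_p _ ->]]; rewrite expn_gt0 prime_gt0. Qed.

(** From [t * C(t - 1, k - 1) = k * C(t, k)]: if [p] did not divide the
    binomial coefficient, [k = p ^ a] would have to divide [t]. *)
Lemma prime_dvd_bin_pred p a t : prime p -> (0 < t)%N ->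
  ~~ (p ^ a %| t)%N -> (p %| 'C(t.-1, (p ^ a).-1))%N.
Proof.
move=> pr_p t_gt0; apply: contraR => pC.
rewrite -(@Gauss_dvdl _ t 'C(t.-1, (p ^ a).-1)) ?coprimeXl ?prime_coprime //.
by rewrite mul_bin_diag prednK ?dvdn_mulr // expn_gt0 prime_gt0.
Qed.

Lemma prime_dvd_bin_exp p a j : prime p -> (0 < j < p ^ a)%N ->
  (p %| 'C(p ^ a, j))%N.
Proof.
move=> pr_p /andP[j_gt0 j_lt]; apply: contraLR j_lt => pC.
rewrite -leqNgt dvdn_leq //.
rewrite -(@Gauss_dvdl _ j 'C(p ^ a, j)) ?coprimeXl ?prime_coprime //.
have := mul_bin_diag (p ^ a) j.-1; rewrite prednK // => <-.
exact: dvdn_mulr.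
Qed.

(** Vandermonde's identity for [2k - 1 = k + (k - 1)]: every term but the first
    contains a factor [C(k, j)] with [0 < j < k]. *)
Lemma bin_double_pred_mod p a : prime p ->
  ('C((2 * p ^ a).-1, (p ^ a).-1) = 1 %[mod p])%N.
Proof.
move=> pr_p; have k_gt0 : (0 < p ^ a)%N by rewrite expn_gt0 prime_gt0.
have -> : (2 * p ^ a).-1 = (p ^ a + (p ^ a).-1)%N by lia.
rewrite -binomial.Vandermonde big_ord_recl /= bin0 subn0 binn mul1n.
have /dvdnP[c ->] : (p %| \sum_(i < (p ^ a).-1)
    'C(p ^ a, bump 0 i) * 'C((p ^ a).-1, (p ^ a).-1 - bump 0 i))%N.
  apply: dvdn_sum => i _; apply: dvdn_mulr; apply: prime_dvd_bin_exp => //.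
  by have := ltn_ord i; rewrite /bump /=; lia.
by rewrite addnC modnMDl.
Qed.

(** * Set families with a forbidden intersection size *)

(** A modular form of the Frankl-Wilson bound.  Let [I] be the inclusion matrix
    between [G] and the [(p ^ a - 1)]-sets that avoid [o].  The entries of
    [I *m I^T] are the binomial coefficients [C(t - 1, p ^ a - 1)], where [t] is
    the size of the intersection, so modulo [p] this product is the identity,
    and [I] has at least as many columns as rows. *)
Lemma card_family_avoiding p a (U : finType) (o : U) (G : {set {set U}}) :
  prime p ->
  (forall A, A \in G -> o \in A /\ #|A| = (2 * p ^ a)%N) ->
  (forall A B, A \in G -> B \in G -> #|A :&: B| != (p ^ a)%N) ->
  (#|G| <= 'C(#|U|.-1, (p ^ a).-1))%N.
Proof.
move=> pr_p GP Gav; set k := (p ^ a)%N in GP Gav *.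
have k_gt0 : (0 < k)%N by rewrite expn_gt0 prime_gt0.
pose D := [set X : {set U} | (X \subset [set~ o]) && (#|X| == k.-1)]%SET.
have <- : #|D| = 'C(#|U|.-1, k.-1).
  by rewrite cards_draws cardsC1.
pose I := \matrix_(i < #|G|, j < #|D|)
  ((enum_val j \subset enum_val i)%:R : 'F_p).
suff /mulmx1_min : I *m I^T = 1%:M by [].
apply/matrixP => i j; rewrite !mxE.
have [oi ci] := GP _ (enum_valP i); have [oj cj] := GP _ (enum_valP j).
set A := enum_val i in oi ci *; set B := enum_val j in oj cj *.
have -> : \sum_l I i l * I^T l j = 'C(#|A :&: B|.-1, k.-1)%:R.
  have oAB : o \in A :&: B by rewrite inE oi oj.
  have -> : #|A :&: B|.-1 = #|(A :&: B) :\ o| by rewrite (cardsD1 o) oAB.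
  rewrite -[in RHS]cards_draws -[in RHS]sum1_card natr_sum.
  have IE l : I i l * I^T l j =
      ((enum_val l \subset A) && (enum_val l \subset B))%:R.
    by rewrite !mxE -natrM mulnb.
  rewrite (eq_bigr _ (fun l _ => IE l)).
  rewrite -(big_enum_val (fun X : {set U} =>
    ((X \subset A) && (X \subset B))%:R : 'F_p)) /=.
  rewrite [RHS]big_mkcond [LHS]big_mkcond /=; apply: eq_bigr => X _.
  rewrite !inE finset.subsetD1 finset.subsetI.
  rewrite -(finset.setCS [set~ o]%SET) finset.setCK finset.sub1set inE.
  by case: (o \in X); case: (#|X| == k.-1); case: (X \subset A);
    case: (X \subset B).
(* Diagonal entries are 1 modulo p, the others vanish. *)
have [eq_ij|ne_ij] := eqVneq i j.
  rewrite /A /B eq_ij finset.setIid -/B cj; apply/eqP.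
  by rewrite -(Fp_nat_mod pr_p) bin_double_pred_mod // Fp_nat_mod.
apply/eqP; rewrite -(dvdn_pcharf (pchar_Fp pr_p)).
have neAB : A != B by apply: contraNneq ne_ij => /enum_val_inj ->.
have t_gt0 : (0 < #|A :&: B|)%N by apply/card_gt0P; exists o; rewrite inE oi oj.
apply: prime_dvd_bin_pred => //.
have t_lt : (#|A :&: B| < 2 * k)%N.
  rewrite -ci; apply: proper_card.
  rewrite properE finset.subsetIl finset.subsetI subxx /=.
  by apply: contra neAB => sAB; rewrite eqEcard sAB ci cj leqnn.
(* The only multiple of k strictly between 0 and 2k is k itself. *)
have := Gav _ _ (enum_valP i) (enum_valP j); rewrite -/A -/B.
apply: contraNN => /dvdnP[c tE]; rewrite tE in t_lt t_gt0 *.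
rewrite -/k in t_lt t_gt0 *.
move: t_gt0 t_lt; rewrite ltn_pmul2r // muln_gt0.
by case: c {tE} => [|[|c]] //; rewrite mul1n.
Qed.

(** * The geometry of cuts *)

Lemma points_indicator (R : realType) (I : finType) (T : {set {set I}}) X :
  X \in T -> points R T (indicator R X).
Proof. by move=> XT; exists X. Qed.

Section Cuts.
Variable k : nat.
Implicit Types A B C : {set ptV k}.

(** Membership in a cut is an exclusive or, hence additive in [A]; this is what
    makes the symmetric difference of two cuts a cut. *)
Lemma mem_cutS A (w : pairW k) (a b : ptV k) :
  val w = [set a; b]%SET -> (w \in cutS A) = (a \in A) (+) (b \in A).
Proof.
move=> wE; rewrite inE wE; apply/existsP/idP => [[x /andP[xA]]|].
  case/existsP=> y /andP[yA /eqP /setP eE].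
  rewrite inE in yA.
  have := eE x; have := eE y; rewrite !inE !eqxx orbT /= => /orP hy /orP hx.
  have nxy : x != y by apply: contraNneq yA => <-.
  case: hx hy nxy => /eqP ? [] /eqP ?; subst; rewrite ?eqxx // => _.
    by rewrite xA (negbTE yA).
  by rewrite xA (negbTE yA).
case aA: (a \in A); case bA: (b \in A) => //= _.
  by exists a; rewrite aA; apply/existsP; exists b; rewrite inE bA /=.
exists b; rewrite bA; apply/existsP; exists a.
by rewrite inE aA /= finset.setUC.
Qed.

Lemma pairWP (w : pairW k) : exists a b : ptV k, val w = [set a; b]%SET.
Proof. by have /cards2P[a [b [_ ->]]] := valP w; exists a, b. Qed.

Lemma cutS_symdiff A B :
  ((cutS A :\: cutS B) :|: (cutS B :\: cutS A) =
   cutS ((A :\: B) :|: (B :\: A)))%SET.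
Proof.
apply/setP => w; have [a [b wE]] := pairWP w.
rewrite finset.in_setU !finset.in_setD !(mem_cutS _ wE) !inE.
by case: (a \in A); case: (a \in B); case: (b \in A); case: (b \in B).
Qed.

Lemma card_cutS A : #|cutS A| = (#|A| * (4 * k - #|A|))%N.
Proof.
have -> : (4 * k - #|A| = #|~: A|)%N.
  by rewrite [RHS]cardsCs finset.setCK card_ord.
rewrite -cardsX -(card_imset _ val_inj).
rewrite -(@card_in_imset _ _ (fun u : ptV k * ptV k => [set u.1; u.2]%SET)).
  congr #|pred_of_set _|; apply/setP => e; apply/imsetP/imsetP.
    case=> w; rewrite inE.
    case/existsP=> a /andP[aA /existsP[b /andP[bA /eqP wE]]] ->.
    by exists (a, b) => //; rewrite finset.in_setX aA.
  case=> -[a b]; rewrite finset.in_setX /= => /andP[aA bA] eE.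
  have e2 : #|e| == 2.
    rewrite eE cards2 (_ : a != b) //.
    by apply: contraTneq bA => <-; rewrite inE aA.
  exists (Sub e e2 : pairW k); last by rewrite SubK.
  have wE : val (Sub e e2 : pairW k) = [set a; b]%SET by rewrite SubK.
  rewrite (mem_cutS _ wE).
  by move: bA; rewrite inE aA => /negbTE ->.
move=> [a b] [c d]; rewrite !finset.in_setX /= !inE.
move=> /andP[aA bA] /andP[cA dA].
move=> /setP E; have := E a; have := E b; rewrite !inE !eqxx orbT /=.
case: (eqVneq b d) => [->|_]; last first.
  by rewrite orbF => /esym/eqP bc; rewrite bc cA in bA.
case: (eqVneq a c) => [->//|_ _]; rewrite orFb => /esym/eqP ad.
by rewrite -ad aA in dA.
Qed.

Lemma card_cutS_symdiff A B : #|A| = (2 * k)%N -> #|B| = (2 * k)%N ->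
  #|((cutS A :\: cutS B) :|: (cutS B :\: cutS A))%SET| =
  (4 * (2 * k - #|A :&: B|) * #|A :&: B|)%N.
Proof.
move=> cA cB; rewrite cutS_symdiff card_cutS.
have -> : #|((A :\: B) :|: (B :\: A))%SET| = (2 * (2 * k - #|A :&: B|))%N.
  rewrite cardsU (_ : (_ :&: _ = finset.set0)%SET) ?cards0 ?subn0; last first.
    by apply/setP => x; rewrite !inE; case: (x \in A); case: (x \in B).
  by rewrite !cardsD cA cB (finset.setIC B A); lia.
have : (#|A :&: B| <= 2 * k)%N.
  by rewrite -cA subset_leq_card // finset.subsetIl.
by move: #|_| => t le_t; have -> : (4 * k - 2 * (2 * k - t) = 2 * t)%N; lia.
Qed.

Lemma setKP (X : {set pairW k}) :
  reflect (exists2 A : {set ptV k}, #|A| = (2 * k)%N & X = cutS A)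
          (X \in setK k).
Proof.
apply: (iffP imsetP) => -[A]; first by rewrite inE => /eqP; exists A.
by exists A => //; rewrite inE; apply/eqP.
Qed.

Lemma cutS_setK A : #|A| = (2 * k)%N -> cutS A \in setK k.
Proof. by move=> cA; apply/setKP; exists A. Qed.

Variable R : realType.

(** With [t] and [2k - t] of sum [2k], the squared distance [4 t (2k - t)] is at
    most [4 k ^ 2], by the inequality between arithmetic and geometric means;
    the value [t = k] attains it. *)
Lemma diam_setK_le (T : {set {set pairW k}}) A B :
  #|A| = (2 * k)%N -> #|B| = (2 * k)%N -> cutS A \in T -> cutS B \in T ->
  #|A :&: B| = k -> diam (points R (setK k)) <= diam (points R T).
Proof.
move=> cA cB AT BT tk.
have Tge := @diam_ub R _ T (indicator R (cutS A)) (indicator R (cutS B)).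
have {}Tge : Num.sqrt (4 * k * k)%:R <= diam (points R T).
  have := Tge (points_indicator _ AT) (points_indicator _ BT).
  rewrite edist_indicator card_cutS_symdiff // tk.
  by have -> : (2 * k - k = k)%N by lia.
case: (diam_attained R (setK k)) => [->|[_ [_ [[X XK <-] [Y YK <-] ->]]]].
  by apply: le_trans Tge; exact: sqrtr_ge0.
apply: le_trans Tge; case/setKP: XK => A' cA' ->; case/setKP: YK => B' cB' ->.
rewrite edist_indicator card_cutS_symdiff //.
apply: ler_wsqrtr; rewrite ler_nat.
have : (#|A' :&: B'| <= 2 * k)%N.
  by rewrite -cA' subset_leq_card // finset.subsetIl.
move: #|_| => t le_t; rewrite -mulnA.
apply: leq_trans (nat_AGM2 (2 * k - t) t) _.
by rewrite subnK // expnMn -mulnn mulnA.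
Qed.

End Cuts.

(** Complementation exchanges the sets of size [2k] that contain [o] with those
    that do not. *)
Lemma card_halfH_at k (o : ptV k) :
  'C(4 * k, 2 * k) = (2 * #|[set A in halfH k | o \in A]%SET|)%N.
Proof.
set G := [set A in halfH k | o \in A]%SET.
have -> : 'C(4 * k, 2 * k) = #|halfH k| by rewrite card_draws card_ord.
have -> : halfH k = (G :|: [set ~: A | A in G])%SET.
  apply/setP => A; rewrite !inE; case oA: (o \in A); rewrite ?andbT ?andbF /=.
    case: eqP => //= cA; apply/esym/negbTE/imsetP => -[B].
    by rewrite !inE => /andP[_ oB] AE; rewrite AE inE oB in oA.
  apply/eqP/imsetP => [cA|[B]].
    exists (~: A)%SET; last by rewrite finset.setCK.
    by rewrite !inE oA andbT cardsCs finset.setCK card_ord cA; apply/eqP; lia.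
  rewrite !inE => /andP[/eqP cB _] ->.
  by rewrite cardsCs finset.setCK card_ord cB; lia.
rewrite cardsU (_ : (_ :&: _ = finset.set0)%SET).
  rewrite cards0 subn0 card_imset; last exact: (can_inj (@finset.setCK _)).
  by rewrite mul2n addnn.
apply/setP => A; rewrite inE finset.in_set0; apply/negP => /andP[].
rewrite !inE => /andP[_ oA] /imsetP[B]; rewrite !inE => /andP[_ oB] AE.
by rewrite AE inE oB in oA.
Qed.

(** * Covers of K *)

(** The [A] of size [2k] through a fixed point are distributed over the members
    of the cover according to [S(A)], and each member receives at most
    [C(4k - 1, k - 1)] of them. *)
Lemma cover_bound k (P : {set {set {set pairW k}}}) : prime_power k ->
  (forall T (A B : {set ptV k}), T \in P ->
     #|A| = (2 * k)%N -> #|B| = (2 * k)%N ->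
     cutS A \in T -> cutS B \in T -> #|A :&: B| != k) ->
  setK k \subset (\bigcup_(T in P) T)%SET ->
  ('C(4 * k, 2 * k) <= 2 * (#|P| * 'C(4 * k - 1, k - 1)))%N.
Proof.
move=> [p [a [pr_p a_gt0 kE]]] Pav Pcov.
have k_gt0 : (0 < k)%N by rewrite kE expn_gt0 prime_gt0.
have lt0 : (0 < 4 * k)%N by lia.
rewrite (card_halfH_at (Ordinal lt0 : ptV k)) leq_mul2l /=.
set o : ptV k := Ordinal _.
set G := [set A in halfH k | o \in A]%SET.
pose piece (T : {set {set pairW k}}) := [set A in G | cutS A \in T]%SET.
have sG : G \subset \bigcup_(T in P) piece T.
  apply/fintype.subsetP => A AG; have : cutS A \in setK k.
    by apply: cutS_setK; move: AG; rewrite !inE => /andP[/eqP].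
  move=> /(fintype.subsetP Pcov) /bigcupP[T TP AT].
  by apply/bigcupP; exists T => //; rewrite inE AG.
apply: leq_trans (subset_leq_card sG) _.
apply: (@leq_trans (\sum_(T in P) #|piece T|)%N).
  apply: (big_ind2 (fun (S : {set {set ptV k}}) n => #|S| <= n)%N) => //.
    by rewrite cards0.
  move=> S1 n1 S2 n2 le1 le2; apply: leq_trans (leq_add le1 le2).
  by rewrite cardsU leq_subr.
rewrite -sum_nat_const; apply: leq_sum => T TP.
have -> : 'C(4 * k - 1, k - 1) = 'C(#|ptV k|.-1, (p ^ a).-1).
  by rewrite card_ord -kE !subn1.
apply: (card_family_avoiding (o := o)) => // [A|A B]; rewrite -kE !inE.
  by move=> /andP[/andP[/eqP -> ->]].
move=> /andP[/andP[/eqP cA _] AT] /andP[/andP[/eqP cB _] BT].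
exact: Pav TP cA cB AT BT.
Qed.

Lemma cover_bound_real (R : realType) k (P : {set {set {set pairW k}}}) :
  prime_power k ->
  (forall T (A B : {set ptV k}), T \in P ->
     #|A| = (2 * k)%N -> #|B| = (2 * k)%N ->
     cutS A \in T -> cutS B \in T -> #|A :&: B| != k) ->
  setK k \subset (\bigcup_(T in P) T)%SET ->
  2^-1 * 'C(4 * k, 2 * k)%:R / 'C(4 * k - 1, k - 1)%:R <= #|P|%:R :> R.
Proof.
move=> hk Pav Pcov; have := cover_bound hk Pav Pcov.
have C_gt0 : (0 < 'C(4 * k - 1, k - 1))%N by rewrite bin_gt0; lia.
rewrite -(ler_nat R) !natrM => le2.
by rewrite ler_pdivrMr ?ltr0n // ler_pdivrMl.
Qed.

Lemma cover_bound_diam (R : realType) k (P : {set {set {set pairW k}}}) :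
  prime_power k ->
  (forall T, T \in P -> diam (points R T) < diam (points R (setK k))) ->
  setK k \subset (\bigcup_(T in P) T)%SET ->
  2^-1 * 'C(4 * k, 2 * k)%:R / 'C(4 * k - 1, k - 1)%:R <= #|P|%:R :> R.
Proof.
move=> hk Pd; apply: cover_bound_real => // T A B TP cA cB AT BT.
apply/eqP => tk; have := Pd _ TP.
by rewrite ltNge (diam_setK_le _ cA cB AT BT tk).
Qed.

(** * Isometries and the hyperplane of constant coordinate sum *)

Lemma diam_isometry (R : realType) (I J : finType) (S : set (euclidean R I))
    (f : euclidean R I -> euclidean R J) :
  (forall x y, S x -> S y -> edist (f x) (f y) = edist x y) ->
  diam (f @` S)%classic = diam S.
Proof.
move=> fiso; rewrite /diam; congr sup.
apply/seteqP; split=> r /= [->|]; try by left.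
  by case=> _ [_ [[x Sx <-] [y Sy <-] ->]]; right; exists x, y; rewrite fiso.
case=> x [y [Sx Sy ->]]; right; exists (f x), (f y).
by rewrite fiso //; split=> //; [exists x|exists y].
Qed.

(** Drop the coordinate [o], add [c] times it to each of the others, and pad
    with zeros.  For a vector [z] of coordinate sum 0 and [N] coordinates, the
    squared norm of the image is that of [z] with [z o ^+ 2] multiplied by
    [(N - 1) c ^ 2 - 2 c]; so [c] is chosen as a root of
    [(N - 1) c ^ 2 - 2 c = 1]. *)
Lemma hyperplane_isometry (R : realType) (I : finType) (n : nat) :
  (1 < #|I|)%N -> (#|I| - 1 <= n)%N ->
  exists f : euclidean R I -> euclidean R 'I_n,
    forall x y : euclidean R I, \sum_i x i = \sum_i y i ->
      edist (f x) (f y) = edist x y.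
Proof.
move=> I_gt1 le_n; have /card_gt0P[o _] : (0 < #|I|)%N by exact: ltnW.
pose s := enum (predC1 o); have sE : size s = (#|I| - 1)%N.
  by rewrite -cardE; have := cardC1 o; rewrite -subn1.
pose N : R := #|I|%:R.
have N1 : N - 1 != 0 by rewrite subr_eq0 pnatr_eq1; lia.
pose c : R := (1 + Num.sqrt N) / (N - 1).
have cE : (N - 1) * c ^+ 2 - 2 * c = 1.
  have := sqr_sqrtr (ler0n R #|I|); rewrite -/N /c; move: (Num.sqrt N) => r rE.
  rewrite -rE in N1 *; field.
  exact: N1.
exists (fun x => [ffun j : 'I_n =>
  if (j < size s)%N then x (nth o s j) + c * x o else 0]).
move=> x y xy; rewrite /edist; congr Num.sqrt.
pose z i := x i - y i.
have z0 : z o = - \sum_(i | i != o) z i.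
  have : \sum_i z i = 0 by rewrite sumrB xy subrr.
  by rewrite (bigD1 o) //= => /eqP; rewrite addr_eq0 => /eqP.
transitivity (\sum_(i | i != o) (z i + c * z o) ^+ 2).
  have -> : \sum_(i | i != o) (z i + c * z o) ^+ 2 =
      \sum_(i <- s) (z i + c * z o) ^+ 2.
    by rewrite big_enum.
  rewrite (big_nth o) big_mkord -sE in le_n *.
  rewrite (big_ord_widen n (fun j => (z (nth o s j) + c * z o) ^+ 2)) //.
  rewrite [RHS]big_mkcond; apply: eq_bigr => j _; rewrite !ffunE.
  by case: ifP => _; [rewrite /z; ring | rewrite subrr expr0n].
rewrite [RHS](bigD1 o) //= -/(z o).
under eq_bigr do rewrite sqrrD.
rewrite !big_split /= sumr_const -mulr_natl.
rewrite -mulr_suml.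
have -> : \sum_(i | i != o) z i = - z o by rewrite z0 opprK.
rewrite (cardC1 o) -subn1 natrB; last exact: ltnW.
have -> : (#|I|%:R - 1) * (c * z o) ^+ 2 =
    ((N - 1) * c ^+ 2 - 2 * c) * z o ^+ 2 + 2 * c * z o ^+ 2.
  by ring.
rewrite cE mul1r; ring.
Qed.

Lemma indicator_sum (R : realType) (I : finType) (X : {set I}) :
  \sum_i indicator R X i = #|X|%:R.
Proof.
rewrite -sum1_card natr_sum [RHS]big_mkcond; apply: eq_bigr => i _.
by rewrite ffunE; case: (i \in X).
Qed.

(** The direction space is the kernel of the coordinate sum, a surjective linear
    form. *)
Lemma in_affine_const_sum (R : realType) (I : finType) (c : R)
    (S : set (euclidean R I)) : (0 < #|I|)%N ->
  (forall x, S x -> \sum_i x i = c) -> in_affine_subspace_of_dim (#|I| - 1) S.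
Proof.
move=> I_gt0 Sc; have /card_gt0P[o _] := I_gt0.
pose sm (x : euclidean R I) : R^o := \sum_i x i.
have sm_lin : linear sm.
  move=> a x y; rewrite /sm scaler_sumr -big_split /=.
  by apply: eq_bigr => i _; rewrite !ffunE.
pose smL := GRing.isLinear.Build _ _ _ _ sm sm_lin.
pose L : {linear euclidean R I -> R^o} := HB.pack sm smL.
pose e (v : R) : euclidean R I := [ffun i => if i == o then v else 0].
have sm_e v : sm (e v) = v.
  rewrite /sm; under eq_bigr do rewrite ffunE.
  by rewrite -big_mkcond big_pred1_eq.
exists (e c), (lker (linfun L)); split.
  have := limg_ker_dim (linfun L) fullv.
  rewrite capfv; have -> : limg (linfun L) = fullv.
    apply: subv_anti; rewrite subvf; apply/subvP => v _.
    have -> : v = linfun L (e v) by rewrite lfunE /= sm_e.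
    exact: memv_img (memvf _).
  have -> : \dim (fullv : {vspace R^o}) = 1%N by rewrite dimvf.
  have -> : \dim (fullv : {vspace euclidean R I}) = #|I|.
    by rewrite dimvf /dim /= muln1.
  by move=> <-; rewrite addnK.
move=> x Sx; rewrite memv_ker lfunE /= /sm.
rewrite -[X in X == _]/(sm (x - e c)).
rewrite (_ : sm _ = sm x - sm (e c)); last exact: (raddfB L).
by rewrite sm_e /sm Sc // subrr.
Qed.

Lemma card_pairW k : #|pairW k| = 'C(4 * k, 2).
Proof.
have -> : (4 * k = #|'I_(4 * k)|)%N by rewrite card_ord.
by rewrite card_sig -card_draws; apply: eq_card => A; rewrite !inE.
Qed.

Lemma points_setK_sum (R : realType) k x :
  points R (setK k) x -> \sum_i x i = (4 * k ^ 2)%:R.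
Proof.
case=> X /= /setKP[A cA ->] <-; rewrite indicator_sum card_cutS cA.
by congr (_%:R); lia.
Qed.

(** * Counterexamples to Borsuk's conjecture *)

(** A division of an isometric copy of [K] pulls back to a cover of [K] by as
    many sets of the same diameters, which the cover bound rules out.  The same
    bound, applied to the one-element cover of [K] by itself, yields the two
    distinct points: some [A] and [B] of size [2k] meet in exactly [k] points,
    as otherwise [q] would be at most 1. *)
Lemma borsuk_counterexample_setK (R : realType) k n : prime_power k ->
  ('C(4 * k, 2) - 1 <= n)%N ->
  n.+1%:R < 2^-1 * 'C(4 * k, 2 * k)%:R / 'C(4 * k - 1, k - 1)%:R :> R ->
  borsuk_counterexample n (points R (setK k)).
Proof.
move=> hk d_le n_lt; set K := points R (setK k).
have k_gt0 := prime_power_gt0 hk.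
have [f fiso] : exists f : euclidean R (pairW k) -> euclidean R 'I_n,
    forall x y, K x -> K y -> edist (f x) (f y) = edist x y.
  have W_gt1 : (1 < #|pairW k|)%N.
    by rewrite card_pairW bin2 -divn2; nia.
  have [|f fiso] := @hyperplane_isometry R (pairW k) n W_gt1.
    by rewrite card_pairW.
  by exists f => x y Kx Ky; apply: fiso; rewrite !(points_setK_sum (k := k)).
exists (f @` K)%classic; split.
- by exists f.
- exists (\sum_(X in setK k) edist (f (indicator R X)) 0).
  move=> _ [_ [X XK <-] <-]; rewrite (bigD1 X) //= lerDl.
  by apply: sumr_ge0 => Y _; exact: sqrtr_ge0.
- suff [A [B [cA cB tk]]] : exists A B : {set ptV k},
      [/\ #|A| = (2 * k)%N, #|B| = (2 * k)%N & #|A :&: B| = k].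
    have [XK YK] := (points_indicator R (cutS_setK cA),
                     points_indicator R (cutS_setK cB)).
    exists (f (indicator R (cutS A))), (f (indicator R (cutS B))).
    split; [by exists (indicator R (cutS A))|by exists (indicator R (cutS B))|].
    move=> eqf; have := fiso _ _ XK YK.
    rewrite eqf edist_indicator card_cutS_symdiff // tk.
    rewrite /edist big1 => [|j _]; last by rewrite subrr expr0n.
    rewrite sqrtr0 => /esym/eqP; rewrite sqrtr_eq0 lern0.
    by apply/negP; lia.
  apply: contrapT => noAB.
  have : 2^-1 * 'C(4 * k, 2 * k)%:R / 'C(4 * k - 1, k - 1)%:R
      <= #|[set setK k]%SET|%:R :> R.
    apply: cover_bound_real => // [_ A B _ cA cB _ _|].
    by apply/eqP => tk; apply: noAB; exists A, B.
    by rewrite big_set1.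
  apply/negP; rewrite -ltNge cards1; apply: le_lt_trans n_lt.
  by rewrite ler_nat.
- case=> F [Fcov _ Fd].
  pose T i := [set X in setK k | `[< F i (f (indicator R X)) >]]%SET.
  pose P := [set T i | i : 'I_n.+1]%SET.
  suff : 2^-1 * 'C(4 * k, 2 * k)%:R / 'C(4 * k - 1, k - 1)%:R <= #|P|%:R :> R.
    apply/negP; rewrite -ltNge; apply: le_lt_trans n_lt.
    by rewrite ler_nat -[leqRHS](card_ord n.+1) leq_imset_card.
  apply: cover_bound_diam => //.
    move=> _ /imsetP[i _ ->]; rewrite -(diam_isometry fiso).
    suff -> : diam (points R (T i)) = diam (F i) by exact: Fd.
    have TK x : points R (T i) x -> K x.
      by case=> X /= + <-; rewrite inE => /andP[XK _]; exists X.
    rewrite -(diam_isometry (f := f)) => [|x y /TK Kx /TK]; last exact: fiso.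
    congr diam; apply/seteqP; split=> y.
      by case=> _ [X /= + <-] <-; rewrite inE => /andP[_ /asboolP].
    move=> Fy; have : (\bigcup_i F i)%classic y by exists i.
    rewrite Fcov => -[_ [X XK <-] yE]; rewrite -yE in Fy *.
    exists (indicator R X) => //; apply: points_indicator.
    by rewrite inE; apply/andP; split=> //; apply/asboolP.
  apply/fintype.subsetP => X XK.
  have : (f @` K)%classic (f (indicator R X)).
    by exists (indicator R X) => //; exact: points_indicator.
  rewrite -Fcov => -[i _ Fi]; apply/bigcupP; exists (T i); first exact: imset_f.
  by rewrite inE XK; apply/asboolP.
Qed.

Theorem mainTheorem1 (R : realType) (k : nat) (hk : prime_power k) :
  let m := (4 * k)%N in
  let d := ('C(m, 2) - 1)%N in
  let q : R := 2^-1 * 'C(m, 2 * k)%:R / 'C(m - 1, k - 1)%:R in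
  [/\ in_affine_subspace_of_dim d (points R (setK k)),
      forall P : {set {set {set pairW k}}},
        (forall T, T \in P ->
           T \subset setK k /\ diam (points R T) < diam (points R (setK k))) ->
        (\bigcup_(T in P) T)%SET = setK k ->
        q <= #|P|%:R
    & (d + 1)%:R < q ->
      forall n : nat, (n = d \/ (d < n)%N /\ n%:R < q - 1) ->
        borsuk_counterexample n (points R (setK k))].
Proof.
move=> m d q; split.
- rewrite /d /m -card_pairW; apply: (@in_affine_const_sum _ _ (4 * k ^ 2)%:R).
    by rewrite card_pairW bin_gt0; have := prime_power_gt0 hk; lia.
  exact: points_setK_sum.
- move=> P PP Pcov; apply: cover_bound_diam => // [T /PP[]//|].
  by rewrite Pcov.
- move=> d_lt n n_d; apply: borsuk_counterexample_setK => //.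
    by case: n_d => [->//|[/ltnW]].
  case: n_d => [->|[_]]; first by rewrite -addn1.
  by rewrite ltrBrDr natr1.
Qed.
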